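(* Fix $a>0$, and let $p_n=\min\{a/n,1\}$ for $n\ge2$. Let $(X_n)_{n\ge1}$ be the coin turning process with turning probabilities $(p_n)$. Then the law of $\frac1N\sum_{i=1}^N X_i$ converges weakly to $\mathsf{Beta}(a,a)$ as $N\to\infty$.
   Context: Given a deterministic sequence $(p_n)_{n\ge2}$ in $[0,1]$, the coin turning process $(X_n)_{n\ge1}$ with values in $\{0,1\}$ is defined as follows: $X_1=1$ or $X_1=0$ with probability $\frac12$ each, and for $n\ge2$, independently of the past, $X_n=1-X_{n-1}$ with probability $p_n$ and $X_n=X_{n-1}$ with probability $1-p_n$. $\mathsf{Beta}(a,a)$ denotes the symmetric Beta distribution on $[0,1]$ with parameter $a>0$, i.e. the law with density proportional to $x^{a-1}(1-x)^{a-1}$ on $(0,1)$. *)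

(* Defs.v *)
From HB Require Import structures.
From mathcomp Require Import all_boot all_order all_algebra.
From mathcomp Require Import all_classical all_reals all_analysis.
From mathcomp Require Import measurable_realfun.
From mathcomp Require Import ring lra.

Set Implicit Arguments.
Unset Strict Implicit.
Unset Printing Implicit Defensive.

Import Order.TTheory GRing.Theory Num.Theory.
Import numFieldNormedType.Exports.

Local Open Scope classical_set_scope.
Local Open Scope ring_scope.

(* Indices start at 1, so X 0 is unconstrained. *)
Definition past_sigma_algebra (R : realType) (d : measure_display)
    (T : measurableType d) (P : probability T R) (X : nat -> {RV P >-> R})
    (n : nat) : set (set T) :=
  <<s \bigcup_(k in [set k | (1 <= k < n)%N]) g_sigma_algebra_preimage (X k) >>.

(* "Independently of the past": conditionally on every event of positive
   probability determined by X_1, ..., X_(n-1), the coin is turned at time n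
   with probability p n; multiplying out covers null events as well. *)
Definition coin_turning_process (R : realType) (d : measure_display)
    (T : measurableType d) (P : probability T R) (p : nat -> R)
    (X : nat -> {RV P >-> R}) : Prop :=
  [/\ forall n w, (1 <= n)%N -> X n w = 0 \/ X n w = 1,
      P [set w | X 1%N w = 1] = (2^-1)%:E,
      P [set w | X 1%N w = 0] = (2^-1)%:E &
      forall n A, (2 <= n)%N -> past_sigma_algebra X n A ->
        P (A `&` [set w | X n w = 1 - X n.-1 w]) = (P A * (p n)%:E)%E /\
        P (A `&` [set w | X n w = X n.-1 w]) = (P A * (1 - p n)%:E)%E].

Definition weak_cvg (R : realType)
    (mu_ : nat -> probability R R)
    (mu : probability R R) : Prop :=
  forall f : R -> R, continuous f -> bounded_fun f ->
    (\int[mu_ n]_x (f x)%:E)%E @[n --> \oo] --> (\int[mu]_x (f x)%:E)%E.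

(* The distribution beta_prob of the library only has natural parameters. *)
Section symmetric_beta.
Context {R : realType}.
Implicit Types a x : R.
Local Notation mu := (@lebesgue_measure R).

Definition sym_beta_weight a x : R := x `^ (a - 1) * (1 - x) `^ (a - 1).

Definition sym_beta_fun a : R := \int[mu]_(x in `]0, 1[) sym_beta_weight a x.

Definition sym_beta_pdf a x : R :=
  (sym_beta_weight a \_ `]0, 1[) x / sym_beta_fun a.

Lemma sym_beta_weight_ge0 a x : 0 <= sym_beta_weight a x.
Proof. by rewrite mulr_ge0 ?powR_ge0. Qed.

Lemma measurable_sym_beta_weight a :
  measurable_fun [set: R] (sym_beta_weight a).
Proof.
apply: measurable_funM => //.
apply: (@measurableT_comp _ _ _ _ _ _ (@powR R ^~ (a - 1))) => //.
exact: measurable_funB.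
Qed.

Let is_derive_primitive a x : 0 < a -> 0 < x -> x < 1 ->
  is_derive x 1 (fun y : R => (y `^ a - (1 - y) `^ a) / a)
    (x `^ (a - 1) + (1 - x) `^ (a - 1)).
Proof.
move=> a0 x0 x1.
have x10 : 0 < 1 - x by lra.
have d1 := is_derive1_powR a x0.
have d2 : is_derive x 1 (fun y : R => (1 - y) `^ a)
    (a * (1 - x) `^ (a - 1) * (-1)).
  have d3 := is_derive1_powR a x10.
  have d4 : is_derive x 1 (fun y : R => 1 - y) (-1 : R).
    have d5 := is_deriveB (is_derive_cst (1 : R) x 1) (is_derive_id x 1).
    by apply: (is_derive_eq d5); rewrite sub0r.
  exact: (@is_derive1_comp _ (fun y : R => y `^ a) (fun y : R => 1 - y)).
have d5 := is_deriveB d1 d2.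
have d6 := is_deriveM d5 (is_derive_cst (a^-1 : R) x 1).
apply: (is_derive_eq d6).
rewrite /= /cst scaler0 add0r /GRing.scale/=.
by field; rewrite gt_eqF.
Qed.

Let weight_le a x : 0 < x -> x < 1 -> sym_beta_weight a x <=
  (1 + 2^-1 `^ (a - 1)) * (x `^ (a - 1) + (1 - x) `^ (a - 1)).
Proof.
have le y : 2^-1 <= y -> y <= 1 -> y `^ (a - 1) <= 1 + 2^-1 `^ (a - 1) :> R.
  move=> y2 y1; have y0 : 0 < y by lra.
  have [a1|a1] := leP 1 a.
    apply: (@le_trans _ _ 1); last by rewrite lerDl powR_ge0.
    rewrite -[leRHS](powRr0 y); apply: ger_powR; first by rewrite y0.
    by rewrite subr_ge0.
  apply: (@le_trans _ _ (2^-1 `^ (a - 1))); last by rewrite lerDr.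
  rewrite -(opprB 1 a) !powRN lef_pV2 ?posrE ?powR_gt0 ?invr_gt0//.
  apply: ge0_ler_powR; rewrite ?nnegrE//; lra.
move=> x0 x1; rewrite /sym_beta_weight.
have u0 := powR_ge0 x (a - 1); have v0 := powR_ge0 (1 - x) (a - 1).
have c0 := powR_ge0 (2^-1 : R) (a - 1).
rewrite mulrDr; have [x2|x2] := leP x 2^-1.
  rewrite (@le_trans _ _ ((1 + 2^-1 `^ (a - 1)) * x `^ (a - 1)))//.
    by rewrite mulrC ler_wpM2r// le//; lra.
  by rewrite lerDl mulr_ge0// addr_ge0.
rewrite (@le_trans _ _ ((1 + 2^-1 `^ (a - 1)) * (1 - x) `^ (a - 1)))//.
  by rewrite ler_wpM2r// le// ltW.
by rewrite lerDr mulr_ge0// addr_ge0.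
Qed.

Let integral_pow_le a (e : R) : 0 < a -> 0 < e -> e < 1 - e ->
  (\int[mu]_(x in `[e, (1 - e)%R]) (x `^ (a - 1) + (1 - x) `^ (a - 1))%:E
   <= (2 / a)%:E)%E.
Proof.
move=> a0 e0 e1.
pose F (y : R) := (y `^ a - (1 - y) `^ a) / a.
have itv01 x : x \in `[e, 1 - e] -> 0 < x /\ x < 1.
  by rewrite in_itv/= => /andP[ex xe]; split; lra.
have cF x : x \in `[e, 1 - e] -> {for x, continuous F}.
  move=> /itv01[x0 x1]; apply/differentiable_continuous/derivable1_diffP.
  by have [] := is_derive_primitive a0 x0 x1.
rewrite (@continuous_FTC2 _ _ F)//.
- rewrite -EFinB lee_fin /F -mulrBl ler_pM2r ?invr_gt0//.
  have -> : 1 - (1 - e) = e by ring.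
  have : (1 - e) `^ a <= 1.
    by rewrite -[leRHS](powRr0 (1 - e)); apply: ger_powR; lra.
  by have := powR_ge0 e a; lra.
- apply: derivable_within_continuous => x /itv01[x0 x1].
  apply: derivableD; first by apply: derivable_powR; rewrite in_itv/= andbT.
  have x10 : 0 < 1 - x by lra.
  apply/derivable1_diffP.
  apply: (@differentiable_comp _ _ _ _ (fun y : R => 1 - y) (@powR R ^~ (a - 1))).
    by apply/derivable1_diffP; exact: derivableB.
  by apply/derivable1_diffP/derivable_powR; rewrite in_itv/= andbT.
- split.
  + move=> x xe; have [x0 x1] : 0 < x /\ x < 1.
      by move: xe; rewrite in_itv/= => /andP[]; split; lra.
    by have [] := is_derive_primitive a0 x0 x1.
  + by apply: cvg_at_right_filter; apply: cF; rewrite in_itv/= lexx ltW.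
  + by apply: cvg_at_left_filter; apply: cF; rewrite in_itv/= lexx ltW.
- move=> x xe; have [x0 x1] : 0 < x /\ x < 1.
    by move: xe; rewrite in_itv/= => /andP[]; split; lra.
  by rewrite derive1E; have [_ ->] := is_derive_primitive a0 x0 x1.
Qed.

Lemma integral_sym_beta_weight_lty a : 0 < a ->
  (\int[mu]_(x in `]0%R, 1%R[) (sym_beta_weight a x)%:E < +oo)%E.
Proof.
move=> a0.
pose E (n : nat) : set R := `[n.+3%:R^-1, 1 - n.+3%:R^-1]%classic.
have EE : \bigcup_n E n = `]0, 1[%classic.
  apply/seteqP; split => x.
    move=> [n _]; rewrite /E /= !in_itv/= => /andP[h1 h2].
    have h : 0 < n.+3%:R^-1 :> R by rewrite invr_gt0 ltr0n.
    by move: (n.+3%:R^-1 : R) h h1 h2 => e h h1 h2; apply/andP; split; lra.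
  rewrite /= in_itv/= => /andP[x0 x1].
  pose m := Num.min x (1 - x).
  have m0 : 0 < m by rewrite lt_min x0; lra.
  exists (Num.truncn m^-1) => //; rewrite /E /= in_itv/=.
  suff : (Num.truncn m^-1).+3%:R^-1 <= m.
    rewrite /m le_min; move: (_^-1) => e /andP[h1 h2].
    by apply/andP; split; lra.
  rewrite -[leRHS]invrK lef_pV2 ?posrE ?invr_gt0//.
  apply: (le_trans (ltW (truncnS_gt _))); by rewrite ler_nat ltnS -addn2 leq_addr.
pose C := (1 + 2^-1 `^ (a - 1) : R).
have C0 : 0 <= C by rewrite addr_ge0// powR_ge0.
have mw D : measurable_fun D (fun x => (sym_beta_weight a x)%:E).
  apply/measurable_funTS/measurable_EFinP.
  exact: measurable_sym_beta_weight.
apply: (@le_lt_trans _ _ (C * (2 / a))%:E); last exact: ltry.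
have ndE : nondecreasing_seq E.
  apply/nondecreasing_seqP => n; rewrite subsetEset => x.
  rewrite /E /= !in_itv/= => /andP[h1 h2].
  have : n.+4%:R^-1 <= n.+3%:R^-1 :> R by rewrite lef_pV2 ?posrE// ler_nat.
  move: (n.+4%:R^-1) (n.+3%:R^-1 : R) h1 h2 => e' e h1 h2 h.
  by apply/andP; split; lra.
have cvgE : (\int[mu]_(x in E n) (sym_beta_weight a x)%:E)%E @[n --> \oo] -->
    (\int[mu]_(x in \bigcup_n E n) (sym_beta_weight a x)%:E)%E.
  apply: ge0_nondecreasing_set_cvg_integral => //.
  - by move=> i; exact: measurable_itv.
  - by move=> i; exact: mw.
  - by move=> i x _; rewrite lee_fin sym_beta_weight_ge0.
rewrite -EE -(cvg_lim _ cvgE)//.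
apply: lime_le; first exact: cvgP cvgE.
apply: nearW => n.
have n0 : 0 < n.+3%:R^-1 :> R by rewrite invr_gt0 ltr0n.
have n1 : n.+3%:R^-1 < 1 - n.+3%:R^-1 :> R.
  have : n.+3%:R^-1 <= 3^-1 :> R by rewrite lef_pV2 ?posrE// ler_nat.
  by move: (n.+3%:R^-1 : R) => e he; lra.
have mg : measurable_fun (E n)
    (fun x : R => (x `^ (a - 1) + (1 - x) `^ (a - 1))%:E).
  apply/measurable_funTS/measurable_EFinP; apply: measurable_funD => //.
  apply: (@measurableT_comp _ _ _ _ _ _ (@powR R ^~ (a - 1))) => //.
  exact: measurable_funB.
apply: (@le_trans _ _ (\int[mu]_(x in E n)
    (C%:E * (x `^ (a - 1) + (1 - x) `^ (a - 1))%:E))%E).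
  apply: ge0_le_integral => //.
  - exact: measurable_itv.
  - by move=> x _; rewrite lee_fin sym_beta_weight_ge0.
  - exact: mw.
  - exact: measurable_funeM.
  - move=> x; rewrite /E /= in_itv/= => /andP[h1 h2].
    move: (n.+3%:R^-1 : R) n0 n1 h1 h2 => e n0 n1 h1 h2.
    by rewrite -EFinM lee_fin weight_le//; lra.
rewrite ge0_integralZl//=.
- by rewrite EFinM lee_pmul// ?lee_fin ?integral_pow_le// integral_ge0// => x _;
    rewrite lee_fin addr_ge0 ?powR_ge0.
- exact: measurable_itv.
- by move=> x _; rewrite lee_fin addr_ge0 ?powR_ge0.
Qed.

Lemma EFin_sym_beta_fun a : 0 < a -> (sym_beta_fun a)%:E =
  (\int[mu]_(x in `]0%R, 1%R[) (sym_beta_weight a x)%:E)%E.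
Proof.
move=> a0; rewrite /sym_beta_fun /Rintegral fineK// ge0_fin_numE.
  exact: integral_sym_beta_weight_lty.
by apply: integral_ge0 => x _; rewrite lee_fin sym_beta_weight_ge0.
Qed.

Lemma sym_beta_fun_ge0 a : 0 <= sym_beta_fun a.
Proof.
by apply: Rintegral_ge0 => x _; exact: sym_beta_weight_ge0.
Qed.

Lemma sym_beta_fun_gt0 a : 0 < a -> 0 < sym_beta_fun a.
Proof.
move=> a0; rewrite lt_neqAle sym_beta_fun_ge0 andbT eq_sym; apply/eqP => B0.
have w0 D : measurable_fun D (fun x => (sym_beta_weight a x)%:E).
  apply/measurable_funTS/measurable_EFinP.
  exact: measurable_sym_beta_weight.
have : (\int[mu]_(x in `]0%R, 1%R[) `|(sym_beta_weight a x)%:E| = 0)%E.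
  under eq_integral do rewrite gee0_abs ?lee_fin ?sym_beta_weight_ge0//.
  by rewrite -EFin_sym_beta_fun// B0.
have m01 : measurable (`]0%R, 1%R[%classic : set R) by exact: measurable_itv.
move=> /(proj1 (ae_eq_integral_abs mu m01 (w0 _)))[N [mN N0 sub]].
have : (mu `]0%R, 1%R[ <= mu N)%E.
  apply: le_measure; rewrite ?inE//.
  move=> x xin; apply: sub => /= /(_ xin) [] /eqP.
  move: xin; rewrite /= in_itv/= => /andP[x0 x1].
  by rewrite gt_eqF// mulr_gt0// powR_gt0//; lra.
by rewrite N0 lebesgue_measure_itv/= lte01 oppr0 adde0 lee_fin ler10.
Qed.

Lemma sym_beta_pdf_ge0 a x : 0 <= sym_beta_pdf a x.
Proof.
rewrite /sym_beta_pdf mulr_ge0 ?invr_ge0 ?sym_beta_fun_ge0//.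
by rewrite patchE; case: ifPn => // _; exact: sym_beta_weight_ge0.
Qed.

Lemma measurable_sym_beta_pdf a : measurable_fun [set: R] (sym_beta_pdf a).
Proof.
apply: measurable_funM => //; apply/measurable_restrict => //.
rewrite setTI; apply: measurable_funTS; exact: measurable_sym_beta_weight.
Qed.

End symmetric_beta.

Definition sym_beta_prob {R : realType} (a : {posnum R})
    (U : set R) : \bar R :=
  (\int[@lebesgue_measure R]_(x in U) (sym_beta_pdf a%:num x)%:E)%E.

Section symmetric_beta_probability.
Context {R : realType} (a : {posnum R}).

Let sym_beta_prob0 : sym_beta_prob a set0 = 0%E.
Proof. exact: integral_set0. Qed.

Let sym_beta_prob_ge0 U : (0 <= sym_beta_prob a U)%E.
Proof. by apply: integral_ge0 => x _; rewrite lee_fin sym_beta_pdf_ge0. Qed.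

Let sym_beta_prob_sigma_additive : semi_sigma_additive (sym_beta_prob a).
Proof.
move=> F mF tF mUF; rewrite /sym_beta_prob; apply: cvg_toP.
  apply: ereal_nondecreasing_is_cvgn => m n mn.
  apply: lee_sum_nneg_natr => // k _ _.
  exact: sym_beta_prob_ge0.
rewrite ge0_integral_bigcup//=.
- apply/measurable_funTS/measurable_EFinP; exact: measurable_sym_beta_pdf.
- by move=> x _; rewrite lee_fin sym_beta_pdf_ge0.
Qed.

HB.instance Definition _ := isMeasure.Build _ _ _ (sym_beta_prob a)
  sym_beta_prob0 sym_beta_prob_ge0 sym_beta_prob_sigma_additive.

Let sym_beta_prob_setT : sym_beta_prob a [set: _] = 1%E.
Proof.
rewrite /sym_beta_prob /sym_beta_pdf; set B := sym_beta_fun _.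
have B0 : 0 < B by exact: sym_beta_fun_gt0.
under eq_integral do rewrite EFinM.
rewrite ge0_integralZr//=.
- rewrite [X in (X * _)%E](_ : _ = B%:E); first by rewrite -EFinM divff ?gt_eqF.
  by rewrite /B EFin_sym_beta_fun// [RHS]integral_mkcond restrict_EFin.
- apply/measurable_EFinP/measurable_restrict => //.
  by rewrite setTI; apply: measurable_funTS; exact: measurable_sym_beta_weight.
- move=> x _; rewrite lee_fin patchE; case: ifPn => // _.
  exact: sym_beta_weight_ge0.
- by rewrite lee_fin invr_ge0 ltW.
Qed.

HB.instance Definition _ := Measure_isProbability.Build _ _ _
  (sym_beta_prob a) sym_beta_prob_setT.

End symmetric_beta_probability.

(* Main.v *)
(* Method of moments. Put S n = X_1 + ... + X_n, W n = 2 S n - n and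
   Y n = 2 X_n - 1, so that W (n+1) = W n + Y (n+1), and Y (n+1) is Y n with its
   sign turned with probability p_(n+1) = a / (n+1). Expanding powers,
     E W(n+1)^k        = E W(n)^k + k E W(n)^(k-1) Y(n) + lower order,
     E W(n+1)^k Y(n+1) = (1 - 2a/(n+1)) E W(n)^k Y(n) + k E W(n)^(k-1)
                         + lower order.
   A sequence with u(n+1) = (1 - c/(n+1)) u(n) + b(n) and b(n) ~ beta n^(k-1)
   satisfies u(n) ~ beta n^k / (k + c). Hence E W(n)^k / n^k tends to m_k, where
   m_0 = 1, m_1 = 0 and (k + 2a) m_(k+1) = k m_(k-1). Integrating the derivative
   of (2x-1)^k x^a (1-x)^a over ]0, 1[ shows that the moments of 2B - 1,
   B ~ Beta(a, a), obey the same recursion. As all the laws live on [0, 1],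
   Bernstein polynomials pass from moments to continuous functions. *)
Require Import Defs.
From HB Require Import structures.
From mathcomp Require Import all_boot all_order all_algebra.
From mathcomp Require Import all_classical all_reals all_analysis.
From mathcomp Require Import measurable_realfun.
From mathcomp Require Import ring lra.

Set Implicit Arguments.
Unset Strict Implicit.
Unset Printing Implicit Defensive.

Import Order.TTheory GRing.Theory Num.Theory.
Import numFieldNormedType.Exports.

Local Open Scope classical_set_scope.
Local Open Scope ring_scope.

(** * Linear recursions with a 1/n contraction *)

(** As long as [g] stays above [eps], each step costs it at least [s * eps / n.+1], so [g n] plus
    [s * eps] times the harmonic partial sum is nonincreasing. Divergence of the harmonic series
    rules this out for all [n]. *)
Lemma contraction_harmonic_lt {R : realType} (g : R^nat) (s eps : R) (m : nat) :
  0 < s -> 0 < eps ->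
  (forall n, (m <= n)%N -> g n.+1 <= (1 - s / n.+1%:R) * g n) ->
  exists2 n, (m <= n)%N & g n < eps.
Proof.
move=> s0 eps0 gS; apply: contrapT => nlt.
have ge n : (m <= n)%N -> eps <= g n.
  by move=> mn; rewrite leNgt; apply/negP => gn; apply: nlt; exists n.
apply: (@dvg_harmonic R); apply: nondecreasing_is_cvgn.
  by apply: nondecreasing_series => n _ _; rewrite /= invr_ge0.
(* [s * eps * C] is the value at [m] of the nonincreasing quantity. *)
pose C := series (@harmonic R) m + g m / (s * eps).
have se0 : 0 < s * eps by rewrite mulr_gt0.
have le k : g (k + m)%N + s * eps * series (@harmonic R) (k + m)%N <=
    s * eps * C.
  elim: k => [|k IH].
    by rewrite /C add0n mulrDr (mulrC _ (g m / _)) divfK ?gt_eqF// addrC.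
  apply: le_trans IH; rewrite addSn seriesSr [harmonic _]/= mulrDr.
  have := gS (k + m)%N (leq_addl _ _).
  have := ge (k + m)%N (leq_addl _ _).
  move: (g _) (g _) (series _ _) => x y z.
  have : 0 < (k + m).+1%:R^-1 :> R by [].
  move: (_^-1) => h h0 ex yx.
  have : 0 <= s * h * (y - eps) by rewrite !mulr_ge0 ?subr_ge0// ltW.
  lra.
exists C => _ [n _ <-].
apply: (@le_trans _ _ (series (@harmonic R) (n + m)%N)).
  by apply: nondecreasing_series; rewrite ?leq_addr// => i _ _; rewrite /= invr_ge0.
rewrite -(ler_pM2l se0); apply: le_trans (le n); rewrite lerDr.
by apply: le_trans (ge _ _); rewrite ?leq_addl// ltW.
Qed.

(** For [s < kappa], eventually [0 <= q n <= 1 - s / n.+1] and [|b n| <= s * (eps / 2)], so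
    [|e n| - eps / 2] contracts by the factor [1 - s / n.+1]. It drops below [eps / 2] once, and the
    contraction then keeps it there. *)
Lemma cvg0_perturbed_contraction {R : realType} (e q b : R^nat) (kappa : R) :
  0 < kappa -> n.+1%:R * (1 - q n) @[n --> \oo] --> kappa ->
  b n @[n --> \oo] --> 0 ->
  (\forall n \near \oo, e n.+1 = q n * e n + b n / n.+1%:R) ->
  e n @[n --> \oo] --> 0.
Proof.
move=> k0 qk b0 eS; apply/cvgr0Pnorm_le => eps eps0.
have [s s0 sk] : exists2 s, 0 < s & s < kappa by exists (kappa / 2); lra.
(* The two bounds involving [kappa + 1] together give [0 <= q n]. *)
have [m _ mP] : \forall n \near \oo, [/\ s <= n.+1%:R * (1 - q n),
    n.+1%:R * (1 - q n) <= kappa + 1, kappa + 1 <= n.+1%:R,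
    `|b n| <= s * (eps / 2) & e n.+1 = q n * e n + b n / n.+1%:R].
  have seps : 0 < s * (eps / 2) by rewrite mulr_gt0// divr_gt0.
  near=> n; split.
  - near: n; apply: (cvgr_ge _ qk); exact: sk.
  - near: n; apply: (cvgr_le _ qk); lra.
  - rewrite (@le_trans _ _ n%:R)// ?ler_nat//; near: n; exact: nbhs_infty_ger.
  - by near: n; apply: (cvgr0_norm_le _ b0).
  - by near: n.
pose g n := `|e n| - eps / 2.
have step n : (m <= n)%N -> 0 <= 1 - s / n.+1%:R /\
    g n.+1 <= (1 - s / n.+1%:R) * g n.
  move=> /mP[/= sq qk1 kn bs eSn].
  have n0 : 0 < n.+1%:R :> R by [].
  have sn : s / n.+1%:R <= 1 - q n by rewrite ler_pdivrMr// mulrC.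
  have q0 : 0 <= q n.
    have : n.+1%:R * (1 - q n) <= n.+1%:R * 1 by rewrite mulr1 (le_trans qk1).
    by rewrite ler_pM2l//; lra.
  have bn : `|b n / n.+1%:R| <= s / n.+1%:R * (eps / 2).
    by rewrite normrM normfV [X in _ / X]ger0_norm// mulrAC ler_wpM2r// invr_ge0 ltW.
  have : `|e n.+1| <= q n * `|e n| + `|b n / n.+1%:R|.
    by rewrite eSn (le_trans (ler_normD _ _))// normrM (ger0_norm q0).
  have := normr_ge0 (e n); rewrite /g.
  move: (s / _) `|b n / _| `|e n| `|e n.+1| sn bn => t y u v sn bn u0 vq.
  split; [lra|nra].
have [n1 mn1 gn1] : exists2 n, (m <= n)%N & g n < eps / 2.
  apply: (@contraction_harmonic_lt _ _ s) => // [|n mn]; first exact: divr_gt0.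
  by case: (step n mn).
exists n1 => //= n n1n.
suff : g n <= eps / 2 by rewrite /g; lra.
rewrite -(subnK n1n); elim: (n - n1)%N => [|k IH]; first by rewrite add0n ltW.
have [t0 gt] := step (k + n1)%N (leq_trans mn1 (leq_addl _ _)).
rewrite addSn (le_trans gt)//.
have : 0 < s / (k + n1).+1%:R by rewrite divr_gt0.
move: IH t0; move: (s / _) (g _) => t x; nra.
Unshelve. all: by end_near.
Qed.

(** [beta / kappa] is the asymptotic fixed point: once it is subtracted, the remaining forcing
    [b n - n.+1 * (1 - q n) * (beta / kappa)] tends to 0. *)
Lemma cvg_perturbed_contraction {R : realType} (r q b : R^nat) (kappa beta : R) :
  0 < kappa -> n.+1%:R * (1 - q n) @[n --> \oo] --> kappa ->
  b n @[n --> \oo] --> beta ->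
  (\forall n \near \oo, r n.+1 = q n * r n + b n / n.+1%:R) ->
  r n @[n --> \oo] --> beta / kappa.
Proof.
move=> k0 qk bb rS.
suff : (r n - beta / kappa) @[n --> \oo] --> (0 : R) by move/subr_cvg0.
apply: (@cvg0_perturbed_contraction _ _ q
  (fun n => b n - n.+1%:R * (1 - q n) * (beta / kappa)) kappa) => //.
  rewrite -(subrr beta) -[X in _ - X](@divfK _ kappa) ?gt_eqF// (mulrC _ kappa).
  by apply: cvgB => //; apply: cvgMl.
apply: filterS rS => n ->; field; rewrite ?gt_eqF//.
Qed.

(** To first order the product is [1 - (k + c) / n.+1]. In the induction, one more factor
    [1 - n.+1^-1] adds the previous product to the sequence, and that product tends to 1. *)
Lemma cvg_growth_exponent {R : realType} (c : R) (k : nat) :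
  n.+1%:R * (1 - (1 - c / n.+1%:R) * (1 - n.+1%:R^-1) ^+ k) @[n --> \oo]
    --> k%:R + c.
Proof.
elim: k => [|k IH].
  rewrite add0r; apply: cvg_near_cst; apply: nearW => n.
  by rewrite expr0; field; rewrite nat1r pnatr_eq0.
pose q (n : nat) := (1 - c / n.+1%:R) * (1 - n.+1%:R^-1) ^+ k.
have q1 : q n @[n --> \oo] --> (1 : R).
  have -> : q = (fun n => 1 - n.+1%:R * (1 - q n) * n.+1%:R^-1).
    by apply/funext => n; rewrite mulrC mulrA mulVf// mul1r subKr.
  rewrite -[X in _ --> X](subr0 (1 : R)) -[X in _ - X](mulr0 (k%:R + c)).
  by apply: cvgB; [exact: cvg_cst|apply: cvgM => //; exact: cvg_harmonic].
have -> : k.+1%:R + c = (k%:R + c) + 1 by rewrite -natr1 addrAC.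
apply: cvg_trans (cvgD IH q1); apply: near_eq_cvg; apply: nearW => n /=.
rewrite fctE /q exprSr; set x := _ ^+ k.
by field; rewrite nat1r pnatr_eq0.
Qed.

(** Dividing the recursion by [n.+1 ^+ k] gives one for [u n / n ^+ k] with factor
    [(1 - c / n.+1) * (n / n.+1) ^+ k], a contraction of rate [k + c]. *)
Lemma cvg_poly_growth {R : realType} (u b : R^nat) (c beta : R) (k : nat) :
  0 < k%:R + c ->
  (\forall n \near \oo, u n.+1 = (1 - c / n.+1%:R) * u n + b n) ->
  n.+1%:R * b n / n.+1%:R ^+ k @[n --> \oo] --> beta ->
  u n / n%:R ^+ k @[n --> \oo] --> beta / (k%:R + c).
Proof.
move=> kc uS bb.
have := @cvg_perturbed_contraction _ (fun n => u n / n%:R ^+ k) _ _ _ _ kc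
  (@cvg_growth_exponent _ c k) bb; apply.
near=> n.
have n0 : n != 0%N by rewrite -lt0n; near: n; exact: nbhs_infty_gt.
have -> : u n.+1 = (1 - c / n.+1%:R) * u n + b n by near: n.
have -> : 1 - n.+1%:R^-1 = n%:R / n.+1%:R :> R.
  by field; rewrite nat1r pnatr_eq0.
by rewrite expr_div_n; field; rewrite nat1r !expf_neq0 ?pnatr_eq0.
Unshelve. all: by end_near.
Qed.

(** * Polynomial approximation on [0, 1] *)

(** Heine's theorem from the near-covering form of compactness; only [x] is confined to the
    segment. *)
Lemma continuous_unif_itv {R : realType} (f : R -> R) (a b eps : R) :
  continuous f -> 0 < eps ->
  exists2 delta : R, 0 < delta & forall x y, a <= x <= b ->
    `|x - y| < delta -> `|f x - f y| <= eps.
Proof.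
move=> cf eps0; have e20 : 0 < eps / 2 by rewrite divr_gt0.
have /compact_near_coveringP cover := @segment_compact R a b.
have cov := cover _ (0^'+ : set_system R)
  (fun delta x => forall y, `|x - y| < delta -> `|f x - f y| <= eps) _.
suff /cov H : forall x, `[a, b]%classic x -> \forall x' \near x & delta \near 0^'+,
    forall y, `|x' - y| < delta -> `|f x' - f y| <= eps.
  have [delta [/= dP delta0]] := @filter_ex _ (0^'+ : set_system R) _ _
    (filterI H (nbhs_right_gt (0 : R))).
  by exists delta => // x y /dP; apply.
move=> x xab.
  have /cvgrPdist_le/(_ _ e20)[r /= r0 rP] := cf x.
  (* With both radii equal to [r / 2], [x'] and [y] lie within [r] of [x], where [f] differs from
     [f x] by at most [eps / 2]. *)
  exists (ball x (r / 2), [set delta | 0 < delta < r / 2]) => /=.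
    split; first by apply: nbhsx_ballx; rewrite divr_gt0.
    near=> t; apply/andP; split => //; near: t.
    by apply: nbhs_right_lt; rewrite divr_gt0.
  move=> [x' delta] /= [xx' /andP[delta0 deltar] y x'y].
  have {}xx' : `|x - x'| < r / 2 by [].
  have h1 : `|f x - f x'| <= eps / 2 by apply: rP => /=; lra.
  have h2 : `|f x - f y| <= eps / 2.
    by apply: rP; rewrite /= (le_lt_trans (ler_distD x' _ _))//; lra.
  by rewrite (le_trans (ler_distD (f x) _ _))// distrC; lra.
Unshelve. all: by end_near.
Qed.

(* The Bernstein operator, as the expectation of [g] at the number of successes
   of [n] independent trials with success probability ['X]. *)
Fixpoint bernstein {R : comNzRingType} (n : nat) (g : nat -> R) : {poly R} :=
  if n is n'.+1 then
    'X * bernstein n' (g \o S) + (1 - 'X) * bernstein n' g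
  else (g 0%N)%:P.

(** The first two binomial moments. Treating all quadratics at once closes the induction, because
    the shift by [S] maps quadratics to quadratics. *)
Lemma bernstein_quad {R : comNzRingType} (n : nat) (a b c x : R) :
  (bernstein n (fun k => a + b * k%:R + c * k%:R ^+ 2)).[x] =
  a + b * (n%:R * x) + c * (n%:R * x * (1 - x) + (n%:R * x) ^+ 2).
Proof.
elim: n a b c => [|n IH] a b c /=; first by rewrite hornerC; ring.
have -> : (fun k => a + b * k%:R + c * k%:R ^+ 2) \o S =
    (fun k => (a + b + c) + (b + 2 * c) * k%:R + c * k%:R ^+ 2).
  by apply/funext => k /=; rewrite -natr1; ring.
have -> : n.+1%:R = n%:R + 1 :> R by rewrite natr1.
by rewrite -polyC1 hornerD !hornerM hornerD hornerN hornerX hornerC !IH; ring.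
Qed.

(** At a point of [0, 1] the operator is an average: it fixes constants and each recursive step is a
    convex combination. *)
Lemma bernstein_dist {R : realDomainType} (n : nat) (g h : nat -> R) (l x : R) :
  0 <= x <= 1 -> (forall k, (k <= n)%N -> `|g k - l| <= h k) ->
  `|(bernstein n g).[x] - l| <= (bernstein n h).[x].
Proof.
move=> /andP[x0 x1]; elim: n g h => [|n IH] g h gh.
  by rewrite /= !hornerC gh.
rewrite /= !hornerE.
have h1 := IH (g \o S) (h \o S) (fun k kn => gh k.+1 kn).
have h0 := IH g h (fun k kn => gh k (leqW kn)).
rewrite (_ : _ - l = x * ((bernstein n (g \o S)).[x] - l) +
  (1 - x) * ((bernstein n g).[x] - l)); last by ring.
by rewrite (le_trans (ler_normD _ _))// !normrM (ger0_norm x0)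
  (@ger0_norm _ (1 - x)) ?subr_ge0// lerD// ler_wpM2l// subr_ge0.
Qed.

(** Bernstein's proof: [|f y - f x| <= eps / 2 + K * (y - x) ^+ 2] holds by uniform continuity for
    close points and by boundedness for distant ones, and the average of [(k / n - x) ^+ 2] is the
    binomial variance [x * (1 - x) / n]. *)
Lemma weierstrass_itv01 {R : realType} (f : R -> R) (eps : R) :
  continuous f -> 0 < eps ->
  exists q : {poly R}, forall x : R, 0 <= x <= 1 -> `|f x - q.[x]| <= eps.
Proof.
move=> cf eps0; have e20 : 0 < eps / 2 by rewrite divr_gt0.
have [delta delta0 unif] := @continuous_unif_itv _ f 0 1 _ cf e20.
have [M M0 fM] : exists2 M : R, 0 < M & forall x, 0 <= x <= 1 -> `|f x| <= M.
  have cf' : {within `[0%R, 1%R], continuous f} by exact: continuous_subspaceT.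
  have [xm _ fm] := EVT_min (@ler01 R) cf'.
  have [xM _ fM] := EVT_max (@ler01 R) cf'.
  exists (`|f xm| + `|f xM| + 1); first by rewrite ltr_wpDl// addr_ge0.
  move=> x x01; have := fm x x01; have := fM x x01.
  have := ler_norm (f xM); have := ler_norm (- f xm); rewrite normrN.
  by have := normr_ge0 (f xM); have := normr_ge0 (f xm); rewrite ler_norml; lra.
(* Chosen so that [K * (y - x) ^+ 2] reaches [2 * M] as soon as [|x - y|] reaches [delta]. *)
pose K := 2 * M / delta ^+ 2.
have K0 : 0 < K by rewrite divr_gt0 ?exprn_gt0// mulr_gt0.
have quad x y : 0 <= x <= 1 -> 0 <= y <= 1 ->
    `|f y - f x| <= eps / 2 + K * (y - x) ^+ 2.
  move=> x01 y01; have [xy|xy] := ltP `|x - y| delta.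
    by rewrite distrC (le_trans (unif _ _ x01 xy))// lerDl mulr_ge0 ?sqr_ge0 ?ltW.
  rewrite (le_trans (ler_normB _ _))//.
  have : 2 * M <= K * (y - x) ^+ 2.
    rewrite /K mulrAC ler_pdivlMr ?exprn_gt0// ler_pM2l ?mulr_gt0//.
    by rewrite -(real_normK (num_real (y - x))) distrC lerXn2r ?nnegrE// ltW.
  by have := fM _ x01; have := fM _ y01; lra.
have [n n_gt0 nK] : exists2 n, (0 < n)%N & K / n%:R <= eps / 2.
  exists (Num.truncn (2 * K / eps)).+1 => //.
  have := truncnS_gt (2 * K / eps); rewrite ltr_pdivrMr// => nK.
  by rewrite ler_pdivrMr ?ltr0n//; move: nK; set t := _.+1%:R; lra.
exists (bernstein n (fun k => f (k%:R / n%:R))) => x x01.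
have n0 : n%:R != 0 :> R by rewrite pnatr_eq0 -lt0n.
(* This is [eps / 2 + K * (k / n - x) ^+ 2], expanded in powers of [k] for [bernstein_quad]. *)
pose h k : R := (eps / 2 + K * x ^+ 2) + (- (2 * K * x / n%:R)) * k%:R +
  K / n%:R ^+ 2 * k%:R ^+ 2.
rewrite distrC (le_trans (@bernstein_dist _ n _ h _ _ x01 _))//.
  move=> k kn; apply: le_trans (quad _ _ x01 _) _.
    by rewrite divr_ge0//= ler_pdivrMr ?ltr0n// mul1r ler_nat.
  by rewrite le_eqVlt; apply/orP; left; apply/eqP; rewrite /h; field.
rewrite bernstein_quad.
apply: (@le_trans _ _ (eps / 2 + K / n%:R * (x * (1 - x)))).
  by rewrite le_eqVlt; apply/orP; left; apply/eqP; field.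
have : x * (1 - x) <= 1 by move: x01 => /andP[]; nra.
have : 0 < K / n%:R by rewrite divr_gt0// ltr0n.
by move: nK; move: (K / _) (x * _) => t s; nra.
Qed.

(** * Moments of the symmetric Beta distribution *)

Section sym_beta_mean.
Context {R : realType} (a : R) (a0 : 0 < a).
Implicit Types (f g : R -> R).
Local Notation mu := (@lebesgue_measure R).

(** The Beta expectation as a quotient of Lebesgue integrals, open to calculus on ]0, 1[;
    [integral_sym_beta_prob] identifies it with the integral against the law. *)
Definition sym_beta_mean f : R :=
  (\int[mu]_(x in `]0%R, 1%R[) (f x * sym_beta_weight a x)) / sym_beta_fun a.

Lemma sym_beta_mean_integrable f : continuous f ->
  mu.-integrable `]0%R, 1%R[ (EFin \o (fun x => f x * sym_beta_weight a x)).
Proof.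
move=> cf.
have -> : EFin \o (fun x => f x * sym_beta_weight a x) =
    ((EFin \o f) \* (EFin \o sym_beta_weight a))%E.
  by apply/funext => x /=; rewrite EFinM.
apply: integrableMr => //.
- by apply: measurable_funTS; exact: continuous_measurable_fun.
- have : compact (f @` `[0%R, 1%R]).
    apply: continuous_compact; last exact: segment_compact.
    exact: continuous_subspaceT.
  move/compact_bounded => [M [Mr HM]]; exists M; split => // y My x xI.
  by apply: HM => //; exists x => //; exact: subset_itv_oo_cc.
- apply/integrableP; split.
    apply/measurable_funTS/measurable_EFinP; exact: measurable_sym_beta_weight.
  apply: le_lt_trans (integral_sym_beta_weight_lty a0).
  rewrite le_eqVlt; apply/orP; left; apply/eqP; apply: eq_integral => x _ /=.
  by rewrite ger0_norm// sym_beta_weight_ge0.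
Qed.

Lemma sym_beta_mean_linear f g (k : R) : continuous f -> continuous g ->
  sym_beta_mean (fun x => k * f x + g x) = k * sym_beta_mean f + sym_beta_mean g.
Proof.
move=> cf cg; rewrite /sym_beta_mean mulrA -mulrDl; congr (_ / _).
rewrite -RintegralZl//; last exact: sym_beta_mean_integrable.
rewrite -RintegralD//; last exact: (sym_beta_mean_integrable cg).
- by apply: eq_Rintegral => x _; rewrite mulrDl mulrA.
- have ckf : continuous (fun x => k * f x).
    by move=> x; apply: (@continuousM _ _ (cst k) f); [exact: cst_continuous|exact: cf].
  rewrite (_ : _ \o _ = EFin \o (fun x => k * f x * sym_beta_weight a x)).
    exact: (sym_beta_mean_integrable ckf).
  by apply/funext => x /=; rewrite mulrA.
Qed.

Lemma sym_beta_mean1 : sym_beta_mean (cst 1) = 1.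
Proof.
rewrite /sym_beta_mean; under eq_Rintegral do rewrite mul1r.
by rewrite -/(sym_beta_fun a) divff// gt_eqF// sym_beta_fun_gt0.
Qed.

Lemma sym_beta_mean_dist f g (eps : R) : continuous f -> continuous g ->
  (forall x : R, 0 <= x <= 1 -> `|f x - g x| <= eps) ->
  `|sym_beta_mean f - sym_beta_mean g| <= eps.
Proof.
move=> cf cg fg; have B0 := sym_beta_fun_gt0 a0.
rewrite /sym_beta_mean -mulrBl normrM [X in _ * X]gtr0_norm ?invr_gt0//.
rewrite ler_pdivrMr// -RintegralB//; try exact: sym_beta_mean_integrable.
have ceps : continuous (cst eps : R -> R) by exact: cst_continuous.
have cfg : continuous (fun x => f x - g x).
  by move=> x; apply: continuousB; [exact: cf|exact: cg].
rewrite (_ : (fun x => f x * _ - _) =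
  fun x => (f x - g x) * sym_beta_weight a x); last first.
  by apply/funext => x; rewrite mulrBl.
rewrite (le_trans (le_normr_Rintegral _ _))//.
  exact: (sym_beta_mean_integrable cfg).
rewrite /sym_beta_fun -RintegralZl//; last first.
  have := sym_beta_mean_integrable (@cst_continuous _ _ (1 : R)).
  by congr (integrable _ _ _); apply/funext => x /=; rewrite mul1r.
apply: le_Rintegral => //; last 1 first.
- move=> x; rewrite /= in_itv/= => /andP[x0 x1]; rewrite normrM.
  rewrite (ger0_norm (sym_beta_weight_ge0 _ _)) ler_wpM2r ?sym_beta_weight_ge0//.
  by rewrite fg// !ltW.
- have /integrable_norm := sym_beta_mean_integrable cfg.
  exact.
- exact: (sym_beta_mean_integrable ceps).
Qed.

End sym_beta_mean.

(* [R] and [measurableTypeR R] carry the same measurable sets with different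
   displays; change of variables needs both measures on the latter. *)
Definition to_measurableTypeR {R : realType} (x : R) : measurableTypeR R := x.

Lemma measurable_to_measurableTypeR {R : realType} :
  measurable_fun [set: R] (@to_measurableTypeR R).
Proof. by move=> _ A mA; rewrite setTI. Qed.

HB.instance Definition _ (R : realType) :=
  isMeasurableFun.Build _ _ _ _ (@to_measurableTypeR R) measurable_to_measurableTypeR.

Section sym_beta_density.
Context {R : realType} (a : {posnum R}).
Local Notation mu := (@lebesgue_measure R).
Local Notation nu := (distribution (sym_beta_prob a) (@to_measurableTypeR R)).

Lemma sym_beta_prob_dom : nu `<< mu.
Proof.
apply/null_content_dominatesP => A mA muA0.
apply: null_set_integral => //.
have mpdf := @measurable_sym_beta_pdf R a%:num.
by apply: measurable_funTS; apply/measurable_EFinP => ? Y mY; exact: mpdf.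
Qed.

(** Change of variables through the Radon-Nikodym derivative, which agrees almost everywhere with
    [sym_beta_pdf] because both have the same integral over every measurable set. *)
Lemma integral_sym_beta_prob (f : R -> R) :
  continuous f -> bounded_fun f ->
  (\int[sym_beta_prob a]_x (f x)%:E = (sym_beta_mean a%:num f)%:E)%E.
Proof.
move=> cf bf.
have mf : measurable_fun setT f by exact: continuous_measurable_fun.
have intf : (sym_beta_prob a).-integrable setT (EFin \o f).
  apply: measurable_bounded_integrable => //.
  by apply: (@le_lt_trans _ _ 1%E); [exact: probability_le1|exact: ltry].
have intf' : nu.-integrable setT (EFin \o f).
  apply: measurable_bounded_integrable => //.
  by apply: (@le_lt_trans _ _ 1%E); [exact: probability_le1|exact: ltry].
have mf' := measurable_int _ intf'.
have mpdf : measurable_fun [set: measurableTypeR R]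
    (EFin \o sym_beta_pdf a%:num : measurableTypeR R -> \bar R).
  by apply/measurable_EFinP => ? Y mY; exact: measurable_sym_beta_pdf.
transitivity (\int[nu]_x (EFin \o f) x)%E.
  by rewrite integral_distribution.
rewrite -(Radon_Nikodym_change_of_variables sym_beta_prob_dom)//=.
transitivity (\int[mu]_x ((f x)%:E * (sym_beta_pdf a%:num x)%:E))%E.
  apply: ae_eq_integral => //.
  - apply: emeasurable_funM => //; apply: (measurable_int mu).
    by apply: Radon_Nikodym_integrable; exact: sym_beta_prob_dom.
  - exact: emeasurable_funM.
  - apply: ae_eqe_mul2l => /=.
    rewrite Radon_NikodymE//=; first exact: sym_beta_prob_dom.
    move=> abmu; case: cid => /= h [h1 h2 h3].
    apply: integral_ae_eq => //=.
    by move=> E E01 mE; rewrite -h3.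
transitivity (\int[mu]_(x in `]0%R, 1%R[)
    (f x * sym_beta_weight a%:num x / sym_beta_fun a%:num)%:E)%E.
  rewrite [RHS]integral_mkcond; apply: eq_integral => x _.
  rewrite -EFinM /sym_beta_pdf !patchE; case: ifP => _; first by rewrite mulrA.
  by rewrite mul0r mulr0.
have fi := sym_beta_mean_integrable (gt0 a) cf.
under eq_integral do rewrite EFinM.
rewrite integralZr//; last exact: fi.
by rewrite -[X in (X * _)%E]fineK ?integrable_fin_num//; exact: fi.
Qed.

End sym_beta_density.

(** [G] may be singular at 0 and 1, so the fundamental theorem is applied on [[e, 1 - e]] with
    [e = n.+3^-1], and dominated convergence with bound [|G|] exhausts ]0, 1[. The shift by 3
    ensures [e < 1 - e]. *)
Lemma Rintegral_itv01_derive {R : realType} (F G : R -> R) (l : R) :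
  (@lebesgue_measure R).-integrable `]0%R, 1%R[ (EFin \o G) ->
  (forall x : R, 0 < x < 1 -> is_derive x 1 F (G x)) ->
  (forall x : R, 0 < x < 1 -> {for x, continuous G}) ->
  F (1 - n.+3%:R^-1) - F n.+3%:R^-1 @[n --> \oo] --> l ->
  \int[lebesgue_measure]_(x in `]0%R, 1%R[) G x = l.
Proof.
move=> iG dF cG Fl.
pose e n : R := n.+3%:R^-1.
have e_gt0 n : 0 < e n by rewrite invr_gt0.
have e_lt n : e n < 1 - e n.
  have : e n <= 3^-1 by rewrite lef_pV2 ?posrE// ler_nat.
  by have := e_gt0 n; lra.
pose E n : set R := `[e n, 1 - e n]%classic.
have sub n x : E n x -> 0 < x < 1.
  by rewrite /E/= in_itv/= => /andP[ex xe]; have := e_gt0 n; lra.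
have intE n : (\int[lebesgue_measure]_(x in E n) (G x)%:E =
    (F (1 - e n) - F (e n))%:E)%E.
  rewrite EFinB; apply: continuous_FTC2 => //.
  - apply: continuous_in_subspaceT => x; rewrite inE => /sub; exact: cG.
  - have cF x : 0 < x < 1 -> {for x, continuous F}.
      move=> /dF [Fx _]; apply/differentiable_continuous.
      exact/derivable1_diffP.
    split.
    + by move=> x xE; have [] := dF x (sub n _ (subset_itv_oo_cc xE)).
    + by apply: cvg_at_right_filter; apply: cF; have := e_lt n; have := e_gt0 n; lra.
    + by apply: cvg_at_left_filter; apply: cF; have := e_lt n; have := e_gt0 n; lra.
  - move=> x xE; rewrite derive1E.
    by have [_ ->] := dF x (sub n _ (subset_itv_oo_cc xE)).
have cvgE : (\int[lebesgue_measure]_(x in E n) (G x)%:E @[n --> \oo] -->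
    \int[lebesgue_measure]_(x in `]0%R, 1%R[) (G x)%:E)%E.
  have mE n : measurable (E n) by exact: measurable_itv.
  have -> : (fun n => \int[lebesgue_measure]_(x in E n) (G x)%:E)%E =
      (fun n => \int[lebesgue_measure]_(x in `]0%R, 1%R[) ((EFin \o G) \_ (E n)) x)%E.
    apply/funext => n; rewrite -integral_mkcondr; congr (integral _ _ _).
    apply/seteqP; split => [x xE|x []//]; split => //=.
    by rewrite in_itv/=; exact: sub xE.
  have mI : measurable (`]0%R, 1%R[%classic : set (measurableTypeR R)).
    exact: measurable_itv.
  have := @dominated_cvg _ _ R (@lebesgue_measure R) _ mI
    (fun n => (EFin \o G) \_ (E n)) (EFin \o G) (abse \o (EFin \o G)).
  apply => //.
  - move=> n; have mEn : measurable (E n : set (measurableTypeR R)) := mE n.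
    apply/(measurable_restrict (EFin \o G) mEn mI).
    apply: (measurable_funS mI _ (measurable_int _ iG)); exact: subIsetl.
  - move=> x; rewrite /= in_itv/= => /andP[x0 x1].
    apply: cvg_near_cst; near=> n; rewrite patchE mem_set//= /E /= in_itv/=.
    have : e n <= Num.min x (1 - x).
      near: n; have m0 : 0 < Num.min x (1 - x) by rewrite lt_min x0; lra.
      have /cvgr0_norm_le/(_ _ m0) := @cvg_harmonic R.
      apply: filterS => n; apply: le_trans; rewrite ger0_norm ?harmonic_ge0//.
      by rewrite lef_pV2 ?posrE// ler_nat !ltnS -addn2 leq_addr.
    by rewrite le_min => /andP[]; lra.
  - by apply: integrable_abse.
  - move=> n x _; rewrite patchE; case: ifPn => // _.
    by rewrite [leLHS]abse0 abse_ge0.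
have : ((F (1 - e n) - F (e n))%:E @[n --> \oo] -->
    \int[lebesgue_measure]_(x in `]0%R, 1%R[) (G x)%:E)%E.
  by under eq_fun do rewrite -intE.
move=> h; rewrite /Rintegral; move/cvg_lim : h => <- //.
have : (F (1 - e n) - F (e n))%:E @[n --> \oo] --> l%:E.
  by apply: cvg_EFin => //; exact: nearW.
by move/cvg_lim => ->.
Unshelve. all: by end_near.
Qed.

Lemma continuous_affineX {R : realType} (j : nat) :
  continuous (fun x : R => (2 * x - 1) ^+ j).
Proof.
move=> x; apply: (@continuous_comp _ _ _ (fun x : R => 2 * x - 1) (fun y => y ^+ j)).
  apply: continuousB; last exact: cst_continuous.
  by apply: continuousM => //; exact: cst_continuous.
exact: exprn_continuous.
Qed.

Lemma is_derive_affineX {R : realType} (j : nat) (x : R) :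
  is_derive x 1 (fun x : R => (2 * x - 1) ^+ j)
    (2 * j%:R * (2 * x - 1) ^+ j.-1).
Proof.
have d : is_derive x 1 (fun x : R => 2 * x - 1) 2.
  have := is_deriveB (is_deriveZ (2 : R) (is_derive_id x 1)) (is_derive_cst (1 : R) x 1).
  by move/is_derive_eq; apply; rewrite subr0 /GRing.scale/= mulr1.
rewrite (_ : (fun _ => _) = (fun x : R => 2 * x - 1) ^+ j); last first.
  by apply/funext => y; rewrite exprfctE.
apply: (is_derive_eq (is_deriveX j d)).
by rewrite /GRing.scale/=; ring.
Qed.

(** The identity [4 * x * (1 - x) = 1 - (2 * x - 1) ^+ 2] turns the product rule into powers of
    [2 * x - 1] times the weight. *)
Lemma is_derive_beta_primitive {R : realType} (a : R) (j : nat) (x : R) :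
  0 < a -> 0 < x < 1 ->
  is_derive x 1 (fun x => (2 * x - 1) ^+ j * (x `^ a * (1 - x) `^ a))
    ((- (j%:R / 2 + a) * (2 * x - 1) ^+ j.+1 + j%:R / 2 * (2 * x - 1) ^+ j.-1)
     * sym_beta_weight a x).
Proof.
move=> a0 /andP[x0 x1]; have x10 : 0 < 1 - x by lra.
have d1 := is_derive1_powR a x0.
have d2 : is_derive x 1 (fun y : R => (1 - y) `^ a)
    (a * (1 - x) `^ (a - 1) * (-1)).
  have d3 := is_derive1_powR a x10.
  have d4 : is_derive x 1 (fun y : R => 1 - y) (-1 : R).
    have d5 := is_deriveB (is_derive_cst (1 : R) x 1) (is_derive_id x 1).
    by apply: (is_derive_eq d5); rewrite sub0r.
  exact: (@is_derive1_comp _ (fun y : R => y `^ a) (fun y : R => 1 - y)).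
have d3 := is_deriveM (is_derive_affineX j x) (is_deriveM d1 d2).
apply: (is_derive_eq d3).
have powE (y : R) : 0 < y -> y `^ a = y * y `^ (a - 1).
  by move=> y0; rewrite -{2}(powRr1 (ltW y0)) -powRD ?subrKC// gt_eqF ?implybT.
rewrite /sym_beta_weight fctE /GRing.scale /= (powE x)// (powE (1 - x))//.
(* At [j = 0] the truncated exponent [j.-1] is harmless, its coefficient being 0. *)
case: j {d3} => [|j] /=; first by rewrite !expr0 expr1; field.
by rewrite !exprS; field.
Qed.

Lemma sym_beta_mean0 {R : realType} (a : R) : 0 < a -> sym_beta_mean a (cst 0) = 0.
Proof.
move=> a0; rewrite /sym_beta_mean; under eq_Rintegral do rewrite mul0r.
by rewrite Rintegral_cst// mul0r mul0r.
Qed.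

(** The primitive vanishes at both ends since [a > 0], so its derivative has mean 0; doubling gives
    the recursion. The case [j = 0] says that [2 * x - 1] has mean 0. *)
Lemma sym_beta_mean_affineX {R : realType} (a : R) (j : nat) : 0 < a ->
  (j%:R + 2 * a) * sym_beta_mean a (fun x => (2 * x - 1) ^+ j.+1) =
  j%:R * sym_beta_mean a (fun x => (2 * x - 1) ^+ j.-1).
Proof.
move=> a0.
(* The summand [cst 0] lets [sym_beta_mean_linear] apply twice. *)
pose h1 (x : R) := j%:R / 2 * (2 * x - 1) ^+ j.-1 + cst 0 x.
pose h (x : R) := - (j%:R / 2 + a) * (2 * x - 1) ^+ j.+1 + h1 x.
have c0 : continuous (cst 0 : R -> R) by exact: cst_continuous.
have cX k (r : R) (f : R -> R) : continuous f ->
    continuous (fun x : R => r * (2 * x - 1) ^+ k + f x : R).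
  move=> cf x.
  apply: (@continuousD _ _ _ (fun x : R => r * (2 * x - 1) ^+ k) f); last exact: cf.
  by apply: (@continuousM _ _ (cst r)); [exact: cst_continuous|exact: continuous_affineX].
have ch1 : continuous h1 by exact: cX.
have ch : continuous h by exact: cX.
have : sym_beta_mean a h = 0.
  rewrite /sym_beta_mean [X in X / _](_ : _ = 0) ?mul0r//.
  apply: (Rintegral_itv01_derive
    (F := fun x => (2 * x - 1) ^+ j * (x `^ a * (1 - x) `^ a))).
  - exact: sym_beta_mean_integrable.
  - move=> x x01; have := is_derive_beta_primitive j a0 x01.
    by rewrite /h /h1 addr0.
  - move=> x /andP[x0 x1]; have x10 : 0 < 1 - x by lra.
    apply: continuousM; first exact: ch.
    have cp (y : R) : 0 < y -> {for y, continuous (@powR R ^~ (a - 1))}.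
      move=> y0; apply/differentiable_continuous/derivable1_diffP.
      by apply: derivable_powR; rewrite in_itv/= andbT.
    apply: continuousM; first exact: cp.
    apply: (@continuous_comp _ _ _ (fun y : R => 1 - y) (@powR R ^~ (a - 1))).
      by apply: continuousB; [exact: cst_continuous|exact: cvg_id].
    exact: cp.
  - have e0 : (n.+3%:R^-1 : R) @[n --> \oo] --> 0^'+.

      have h0 : (n.+3%:R^-1 : R) @[n --> \oo] --> 0.
        apply: (@cvg_comp _ _ _ (addn 2) (@harmonic R)); first exact: cvg_addnl.
        exact: cvg_harmonic.
      move=> A /= [r /= r0 rA]; have /cvgr0_norm_lt/(_ _ r0) := h0.
      by apply: filterS => n nr; apply: rA => //=; rewrite sub0r normrN.
    have ea : (2 * (n.+3%:R^-1 : R) `^ a) @[n --> \oo] --> (0 : R).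
      rewrite -(mulr0 (2 : R)); apply: cvgM; first exact: cvg_cst.
      exact: (cvg_comp _ _ e0 (powR_cvg0 a0)).
    (* Each boundary value is at most [e ^ a] in absolute value, as [|2 * x - 1| <= 1] and
       [(1 - e) ^ a <= 1]; hence the bound [2 * e ^ a]. *)
    apply/norm_cvg0P; apply: (squeeze_cvgr _ (cvg_cst (0:R)) ea).
    apply: nearW => n; rewrite normr_ge0/=.
    have e_gt0 : 0 < n.+3%:R^-1 :> R by [].
    have e_le : n.+3%:R^-1 <= 3^-1 :> R by rewrite lef_pV2 ?posrE// ler_nat.
    move: (n.+3%:R^-1 : R) e_gt0 e_le => e e_gt0 e_le.
    have bnd (x : R) : 0 < x < 1 -> `|(2 * x - 1) ^+ j * (x `^ a * (1 - x) `^ a)| <=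
        x `^ a * (1 - x) `^ a.
      move=> /andP[x0 x1].
      rewrite normrM [X in _ * X]ger0_norm ?mulr_ge0 ?powR_ge0//.
      rewrite ler_piMl ?mulr_ge0 ?powR_ge0//.
      by rewrite normrX exprn_ile1// ler_norml; lra.
    have pe1 : (1 - e) `^ a <= 1.
      by rewrite -[leRHS](powRr0 (1 - e)); apply: ger_powR; lra.
    have pe : e `^ a * (1 - e) `^ a <= e `^ a by rewrite ler_piMr ?powR_ge0.
    rewrite (le_trans (ler_normB _ _))// [leRHS](mulrDl 1 1) !mul1r lerD//.
      by rewrite (le_trans (bnd _ _))// ?subKr 1?mulrC//; lra.
    by rewrite (le_trans (bnd _ _))//; lra.
rewrite sym_beta_mean_linear//; last exact: continuous_affineX.
rewrite sym_beta_mean_linear//; last exact: continuous_affineX.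
by rewrite sym_beta_mean0//; lra.
Qed.

(** * The law of (S_n, X_n) *)

(** The integrand is a finite combination of indicators of the fibres of [state]. *)
Lemma integral_finite_range {R : realType} (d : measure_display)
    (T : measurableType d) (P : probability T R) (I : finType) (state : T -> I)
    (c : I -> R) :
  (forall i, measurable (state @^-1` [set i])) ->
  (\int[P]_w (c (state w))%:E =
   (\sum_i c i * fine (P (state @^-1` [set i])))%:E)%E.
Proof.
move=> mstate.
have -> : (fun w => (c (state w))%:E) =
    (fun w => \sum_i (c i)%:E * (\1_(state @^-1` [set i]) w)%:E)%E.
  apply/funext => w; rewrite (bigD1 (state w))//= big1 ?adde0.
    by rewrite indicE mem_set// mule1.
  by move=> i iw; rewrite indicE memNset ?mule0// => /= wi; rewrite -wi eqxx in iw.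
rewrite integral_sum//; last first.
  by move=> i; apply: integrableZl => //; exact: integrable_indic.
rewrite -sumEFin; apply: eq_bigr => i _.
rewrite integralZl//; last exact: integrable_indic.
by rewrite integral_indic// setIT EFinM fineK// fin_num_measure.
Qed.

Section coin_turning_state.
Context {R : realType} {d : measure_display} {T : measurableType d}
  (P : probability T R) (p : nat -> R) (X : nat -> {RV P >-> R}).
Context (turningX : coin_turning_process p X).

Definition heads (n : nat) (w : T) : R := \sum_(1 <= i < n.+1) X i w.

(** A finite encoding of (S_n, X_n). It loses nothing: [heads n w] is a natural number at most [n],
    so [truncn] is exact and [inord] never takes its default value. *)
Definition state (n : nat) (w : T) : 'I_n.+1 * bool :=
  (inord (Num.truncn (heads n w)), X n w == 1).

Definition state_prob (n : nat) (i : 'I_n.+1 * bool) : R :=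
  fine (P (state n @^-1` [set i])).

(* The expectation of [h (heads n) (X n)], for [1 <= n]; being a finite sum, it
   needs no measurability of [h]. *)
Definition state_mean (n : nat) (h : R -> R -> R) : R :=
  \sum_(i : 'I_n.+1 * bool) h (i.1 : nat)%:R (i.2 : nat)%:R * state_prob i.

Lemma coinE n w : (1 <= n)%N -> X n w = (X n w == 1 : nat)%:R.
Proof.
move=> n1; case: turningX => X01 _ _ _; have [->|->] := X01 n w n1; last by rewrite eqxx.
by rewrite eq_sym oner_eq0.
Qed.

Lemma headsS n w : heads n.+1 w = heads n w + X n.+1 w.
Proof. by rewrite /heads big_nat_recr. Qed.

Lemma headsE n w : heads n w = ((state n w).1 : nat)%:R.
Proof.
suff [m mn hm] : exists2 m : nat, (m <= n)%N & heads n w = m%:R.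
  by rewrite /state /= hm natrK inordK.
elim: n => [|n [m mn hm]]; first by exists 0%N => //; rewrite /heads big_geq.
exists (m + (X n.+1 w == 1%R))%N; last by rewrite headsS hm natrD -coinE.
by case: eqP => _; rewrite ?addn1 ?addn0// leqW.
Qed.

Lemma stateE n (i : 'I_n.+1 * bool) w : (1 <= n)%N ->
  (state n w = i) <-> (heads n w = (i.1 : nat)%:R /\ X n w = (i.2 : nat)%:R).
Proof.
case: i => s x n1; split=> [<-|[/= hs Xx]]; first by rewrite -headsE /= -coinE.
rewrite /state hs Xx natrK inord_val; congr pair.
by rewrite pnatr_eq1; case: x {Xx}.
Qed.

(** This makes the turning hypothesis at time [n.+1] applicable conditionally on the state at time
    [n]. *)
Lemma past_state n (i : 'I_n.+1 * bool) : (1 <= n)%N ->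
  past_sigma_algebra X n.+1 (state n @^-1` [set i]).
Proof.
move=> n1; rewrite /past_sigma_algebra; set G := \bigcup_(_ in _) _.
have mX k : (1 <= k <= n)%N ->
    measurable_fun setT (X k : g_sigma_algebraType G -> R).
  move=> kn _ B mB; rewrite setTI; apply: sub_sigma_algebra.
  by exists k => //; exists B => //; rewrite setTI.
have mS : measurable_fun setT (heads n : g_sigma_algebraType G -> R).
  (* The guard replaces terms outside the range by 0, since measurability is asked of every summand
     and only [X 1, ..., X n] belong to the past. *)
  rewrite (_ : heads n =
    fun w => \sum_(1 <= k < n.+1) (if (1 <= k <= n)%N then X k w else 0)).
    apply: measurable_sum => k; case: (boolP (1 <= k <= n)%N) => [kn|_].
      exact: mX.
    exact: measurable_cst.
  by apply/funext => w; apply: eq_big_nat => k; rewrite ltnS => ->.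
have -> : state n @^-1` [set i] =
    heads n @^-1` [set (i.1 : nat)%:R] `&` X n @^-1` [set (i.2 : nat)%:R].
  by apply/seteqP; split => w /=; rewrite stateE.
have mSs := mS measurableT _ (measurable_set1 (i.1 : nat)%:R).
have mXs := mX n _ measurableT _ (measurable_set1 (i.2 : nat)%:R).
rewrite !setTI in mSs mXs; apply: measurableI mSs (mXs _).
by rewrite n1 leqnn.
Qed.

Lemma past_measurable n A : past_sigma_algebra X n A -> measurable A.
Proof.
move: A; apply: smallest_sub; first exact: sigma_algebra_measurable.
by move=> A [k _ [B mB <-]]; exact: measurable_funP.
Qed.

Lemma integral_state n (h : R -> R -> R) : (1 <= n)%N ->
  (\int[P]_w (h (heads n w) (X n w))%:E = (state_mean n h)%:E)%E.
Proof.
move=> n1; rewrite /state_mean -(@integral_finite_range _ _ _ _ _ (state n)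
  (fun i : 'I_n.+1 * bool => h (i.1 : nat)%:R (i.2 : nat)%:R)).
  by apply: eq_integral => w _; rewrite headsE /= -coinE.
by move=> i; apply: (@past_measurable n.+1); exact: past_state.
Qed.

(** One step of the Markov chain (S_n, X_n): each fibre of the state is split according to whether
    the coin stays or turns, and independence of the past supplies the weights. *)
Lemma state_meanS n (h : R -> R -> R) : (1 <= n)%N ->
  state_mean n.+1 h = state_mean n (fun s x =>
    (1 - p n.+1) * h (s + x) x + p n.+1 * h (s + (1 - x)) (1 - x)).
Proof.
move=> n1; apply: EFin_inj; rewrite -integral_state//.
have [X01 _ _ turn] := turningX.
pose next w := (state n w, X n.+1 w == X n w).
pose stay := [set w | X n.+1 w = X n w].
pose flip := [set w | X n.+1 w = 1 - X n w].
(* For coins with values 0 and 1, not staying is the same as turning. *)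
have nextE i (b : bool) : next @^-1` [set (i, b)] =
    state n @^-1` [set i] `&` (if b then stay else flip).
  apply/seteqP; split => w; rewrite /next /=.
    case=> -> <-; split => //; case: eqP => // /eqP.
    rewrite /flip /= (coinE w (n := n.+1))// (coinE w n1).
    by case: (_ == 1); case: (_ == 1); rewrite /= ?subrr ?subr0 ?eqxx.
  move=> [->]; case: b => /= [->|->]; first by rewrite eqxx.
  congr pair; rewrite (coinE w n1).
  by case: (_ == 1); rewrite ?subrr ?subr0 ?oner_eq0// eq_sym oner_eq0.
have meq (f g : T -> R) : measurable_fun setT f -> measurable_fun setT g ->
    measurable [set w | f w = g w].
  move=> mf mg.
  have /(_ measurableT [set true] I) := @measurable_fun_eqr _ _ _ _ f g mf mg.
  by rewrite setTI; congr measurable; apply/seteqP; split => w /= /eqP.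
have mstay : measurable stay by exact: meq.
have mflip : measurable flip by apply: meq => //; exact: measurable_funB.
have ms i : measurable (state n @^-1` [set i]).
  by apply: (@past_measurable n.+1); exact: past_state.
pose c (j : ('I_n.+1 * bool) * bool) := let s := (j.1.1 : nat)%:R in
  let x := (j.1.2 : nat)%:R in
  if j.2 then h (s + x) x else h (s + (1 - x)) (1 - x).
transitivity (\int[P]_w (c (next w))%:E)%E.
  apply: eq_integral => w _; rewrite headsS /c /= -headsE -coinE//.
  have : (next @^-1` [set (state n w, X n.+1 w == X n w)]) w by [].
  rewrite nextE => -[_]; case: eqP => [->//|_ /= ->//].
rewrite integral_finite_range; last first.
  by move=> [i []]; rewrite nextE; exact: measurableI.
congr EFin; rewrite /state_mean [LHS]/=.
transitivity (\sum_i \sum_b c (i, b) * fine (P (next @^-1` [set (i, b)]))).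
  by rewrite pair_bigA; apply: eq_bigr => -[].
apply: eq_bigr => i _; rewrite big_bool /= !nextE.
have [Pf Ps] := turn n.+1 _ n1 (past_state i n1).
have Pi : P (state n @^-1` [set i]) \is a fin_num by rewrite fin_num_measure.
rewrite -/stay -/flip in Pf Ps.
rewrite Pf Ps !fineM// /state_prob /c /=; ring.
Qed.

Lemma eq_state_mean n (h g : R -> R -> R) :
  (forall (s : nat) (x : bool), (s <= n)%N -> h s%:R x%:R = g s%:R x%:R) ->
  state_mean n h = state_mean n g.
Proof.
by move=> hg; apply: eq_bigr => -[s x] _; rewrite hg//= -ltnS.
Qed.

Lemma state_meanD n (h g : R -> R -> R) :
  state_mean n (fun s x => h s x + g s x) = state_mean n h + state_mean n g.
Proof.
by rewrite /state_mean -big_split; apply: eq_bigr => i _; rewrite mulrDl.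
Qed.

Lemma state_meanZ n (c : R) (h : R -> R -> R) :
  state_mean n (fun s x => c * h s x) = c * state_mean n h.
Proof.
by rewrite /state_mean mulr_sumr; apply: eq_bigr => i _; rewrite mulrA.
Qed.

Lemma state_mean_cst n (c : R) : (1 <= n)%N -> state_mean n (fun _ _ => c) = c.
Proof.
move=> n1; apply: EFin_inj; rewrite -integral_state//.
by rewrite integral_cst//= probability_setT mule1.
Qed.

Lemma state_mean_norm n (h : R -> R -> R) (c : R) : (1 <= n)%N ->
  (forall (s : nat) (x : bool), (s <= n)%N -> `|h s%:R x%:R| <= c) ->
  `|state_mean n h| <= c.
Proof.
move=> n1 hc; rewrite -(state_mean_cst c n1).
rewrite (le_trans (ler_norm_sum _ _ _))//; apply: ler_sum => -[s x] _.
have s0 : 0 <= state_prob (s, x) by rewrite fine_ge0.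
by rewrite normrM (ger0_norm s0) ler_wpM2r// hc//= -ltnS.
Qed.

End coin_turning_state.

(** * Moments of 2 S_n - n *)

(** The remainder of the first-order Taylor expansion of the [k]-th power at [w]. *)
Definition expr_remainder {R : comPzRingType} (k : nat) (w y : R) : R :=
  (w + y) ^+ k - w ^+ k - k%:R * w ^+ k.-1 * y.

(** Induction through R_(k+1) = (w + y) R_k + k w^(k-1) y^2, with [|w + y| <= 2 * n]. The order
    n^(k-2) is written as a quotient to avoid truncated subtraction when [k < 2]. *)
Lemma expr_remainder_bound {R : realFieldType} (k : nat) :
  exists2 c : R, 0 <= c & forall (n : nat) (w y : R), (0 < n)%N ->
    `|w| <= n%:R -> `|y| <= 1 ->
    `|expr_remainder k w y| <= c * n%:R ^+ k / n%:R ^+ 2.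
Proof.
elim: k => [|k [c c0 IH]].
  by exists 0 => // n w y *; rewrite /expr_remainder !expr0 subrr !mul0r subr0 normr0.
exists (2 * c + k%:R) => [|n w y n0 wn y1]; first by rewrite addr_ge0// mulr_ge0.
have n1 : 1 <= n%:R :> R by rewrite ler1n.
have nn0 : n%:R != 0 :> R by rewrite pnatr_eq0 -lt0n.
have -> : expr_remainder k.+1 w y =
    (w + y) * expr_remainder k w y + k%:R * w ^+ k.-1 * y ^+ 2.
  rewrite /expr_remainder; case: k {IH} => [|k]; first by rewrite !expr0 expr1; ring.
  by rewrite /= !exprS -(natr1 k.+1); ring.
have -> : (2 * c + k%:R) * n%:R ^+ k.+1 / n%:R ^+ 2 =
    2 * n%:R * (c * n%:R ^+ k / n%:R ^+ 2) + k%:R * (n%:R ^+ k / n%:R).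
  by rewrite exprS; field.
rewrite (le_trans (ler_normD _ _))// lerD// !normrM.
  rewrite ler_pM// ?IH//; apply: le_trans (ler_normD _ _) _.
  by rewrite mulrDl mul1r lerD// (le_trans y1).
rewrite normr_nat -mulrA; case: k {IH} => [|k]; first by rewrite !mul0r.
rewrite ler_wpM2l//= exprS mulrAC divff// mul1r.
rewrite -[leRHS]mulr1 ler_pM// ?mulr_ile1//.
by rewrite normrX lerXn2r ?nnegrE.
Qed.

Lemma cvg_shift_denominator {R : realType} (u : R^nat) (k : nat) (l : R) :
  u n / n%:R ^+ k @[n --> \oo] --> l -> u n / n.+1%:R ^+ k @[n --> \oo] --> l.
Proof.
move=> ul.
have h1 : (1 - n.+1%:R^-1 : R) @[n --> \oo] --> (1 : R).
  rewrite -[X in _ --> X](subr0 (1 : R)).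
  by apply: cvgB; [exact: cvg_cst|exact: cvg_harmonic].
have hk : (1 - n.+1%:R^-1 : R) ^+ k @[n --> \oo] --> (1 : R).
  rewrite -[X in _ --> X](expr1n _ k).
  exact: (cvg_comp _ _ h1 (@exprn_continuous R k 1)).
rewrite -[l]mulr1; apply: cvg_trans (cvgM ul hk); apply: near_eq_cvg.
near=> n => /=.
have n0 : (n != 0)%N by rewrite -lt0n; near: n; exact: nbhs_infty_gt.
have -> : 1 - n.+1%:R^-1 = n%:R / n.+1%:R :> R.
  by field; rewrite nat1r pnatr_eq0.
by rewrite expr_div_n; field; rewrite !expf_neq0 ?pnatr_eq0.
Unshelve. all: by end_near.
Qed.

(** Puts the leading term of the recursion of order [k.+1] in the form of the forcing in
    [cvg_poly_growth]. *)
Lemma cvg_lead_term {R : realType} (u : R^nat) (k : nat) (l : R) :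
  u n / n%:R ^+ k @[n --> \oo] --> l ->
  n.+1%:R * (k.+1%:R * u n) / n.+1%:R ^+ k.+1 @[n --> \oo] --> k.+1%:R * l.
Proof.
move=> /cvg_shift_denominator ul.
apply: cvg_trans (cvgM (cvg_cst (k.+1%:R : R)) ul).
apply: near_eq_cvg; apply: nearW => n; rewrite /= exprS; field.
by rewrite ?nat1r expf_neq0 pnatr_eq0.
Qed.

Lemma cvg0_remainder {R : realType} (b : R^nat) (k : nat) (c : R) :
  (forall n, (0 < n)%N -> `|b n| <= c * n%:R ^+ k / n%:R ^+ 2) ->
  n.+1%:R * b n / n.+1%:R ^+ k @[n --> \oo] --> (0 : R).
Proof.
move=> bc.
have c0 : 0 <= c by have := bc 1%N isT; rewrite !expr1n divr1 mulr1; exact: le_trans.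
(* The 4 comes from [n.+1 <= 2 * n], squared. *)
have h : 4 * c * harmonic n @[n --> \oo] --> (0 : R).
  by rewrite -(mulr0 (4 * c)); apply: cvgM; [exact: cvg_cst|exact: cvg_harmonic].
apply/norm_cvg0P; apply: (squeeze_cvgr _ (cvg_cst (0 : R)) h).
near=> n; rewrite normr_ge0 /=.
have n_gt0 : (0 < n)%N by near: n; exact: nbhs_infty_gt.
have n0 : 0 < n%:R :> R by rewrite ltr0n.
have n1 : 1 <= n%:R :> R by rewrite ler1n.
rewrite !normrM normfV normrX normr_nat.
rewrite mulrAC -ler_pdivlMl ?divr_gt0 ?exprn_gt0// (le_trans (bc _ n_gt0))//.
rewrite (_ : (_ / _)^-1 * _ = 4 * c * n.+1%:R ^+ k / n.+1%:R ^+ 2); last first.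
  by field; rewrite nat1r expf_neq0 pnatr_eq0.
rewrite ler_pdivrMr ?exprn_gt0// mulrAC ler_pdivlMr ?exprn_gt0//.
rewrite (_ : 4 * c * _ * _ = c * (n.+1%:R ^+ k * (2 * n%:R) ^+ 2)); last by ring.
rewrite -mulrA ler_wpM2l// ler_pM ?exprn_ge0// lerXn2r ?nnegrE ?mulr_ge0//.
  by rewrite ler_nat.
by rewrite -natr1; lra.
Unshelve. all: by end_near.
Qed.

Section moments.
Context {R : realType} {d : measure_display} {T : measurableType d}
  (P : probability T R) (p : nat -> R) (X : nat -> {RV P >-> R}).
Context (turningX : coin_turning_process p X).
Context (p01 : forall n, 0 <= p n <= 1).

(** For [1 <= n], this and [walk_cross_moment] are E W(n)^k and E W(n)^k Y(n). *)
Definition walk_moment (k n : nat) : R :=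
  state_mean X n (fun s _ => (2 * s - n%:R) ^+ k).

Definition walk_cross_moment (k n : nat) : R :=
  state_mean X n (fun s x => (2 * s - n%:R) ^+ k * (2 * x - 1)).

Lemma walk_norm_le (n s : nat) : (s <= n)%N -> `|2 * s%:R - n%:R : R| <= n%:R.
Proof.
rewrite -(ler_nat R) => sn; have : 0 <= s%:R :> R by [].
by move: sn; move: (s%:R) (n%:R) => x y xy x0; rewrite ler_norml; lra.
Qed.

Let norm_mix (q u v e c : R) : 0 <= q <= 1 -> `|u| <= c -> `|v| <= c -> `|e| <= 1 ->
  `|((1 - q) * u + q * v) * e| <= c.
Proof.
move=> /andP[q0 q1] uc vc e1; have c0 : 0 <= c by exact: le_trans uc.
rewrite normrM -[leRHS]mulr1 ler_pM// (le_trans (ler_normD _ _))//.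
rewrite !normrM (ger0_norm q0) ger0_norm ?subr_ge0//.
have : (1 - q) * `|u| <= (1 - q) * c by rewrite ler_wpM2l// subr_ge0.
by have : q * `|v| <= q * c by [rewrite ler_wpM2l]; lra.
Qed.

(** The increment of W is Y(n) or -Y(n), with conditional mean [(1 - 2 * p n.+1)] times Y(n); this
    gives the linear term, and what is left is a mixture of Taylor remainders. *)
Lemma walk_momentS (k : nat) : exists c, forall n, (0 < n)%N ->
  `|walk_moment k n.+1 - walk_moment k n
    - (1 - 2 * p n.+1) * (k%:R * walk_cross_moment k.-1 n)|
    <= c * n%:R ^+ k / n%:R ^+ 2.
Proof.
have [c c0 cP] := @expr_remainder_bound R k; exists c => n n0.
(* The final factor 1 gives the shape required by [norm_mix]. *)
pose rem (s x : R) := ((1 - p n.+1) * expr_remainder k (2 * s - n%:R) (2 * x - 1) +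
  p n.+1 * expr_remainder k (2 * s - n%:R) (- (2 * x - 1))) * 1.
have -> : walk_moment k n.+1 = walk_moment k n +
    ((1 - 2 * p n.+1) * k%:R * walk_cross_moment k.-1 n + state_mean X n rem).
  rewrite /walk_moment (state_meanS turningX)// -state_meanZ -!state_meanD.
  apply: eq_state_mean => s x sn.
  rewrite (_ : 2 * (s%:R + x%:R) - _ = (2 * s%:R - n%:R) + (2 * x%:R - 1)); last first.
    by rewrite -natr1; ring.
  rewrite (_ : 2 * (s%:R + (1 - x%:R)) - _ =
    (2 * s%:R - n%:R) + - (2 * x%:R - 1)); last first.
    by rewrite -natr1; ring.
  by rewrite /rem /expr_remainder; ring.
rewrite (_ : _ - _ - _ = state_mean X n rem); last by ring.
apply: (state_mean_norm turningX) => // s x sn.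
have y1 : `|2 * (x%:R : R) - 1| <= 1 by case: x {sn} => /=; rewrite ler_norml; lra.
by apply: norm_mix => //; rewrite ?normr1//; apply: cP; rewrite ?normrN// walk_norm_le.
Qed.

(** Y(n+1) is itself the increment of W, so the linear Taylor term carries its square, which is 1:
    the turning probability disappears from that term. *)
Lemma walk_cross_momentS (k : nat) : exists c, forall n, (0 < n)%N ->
  `|walk_cross_moment k n.+1 - (1 - 2 * p n.+1) * walk_cross_moment k n
    - k%:R * walk_moment k.-1 n| <= c * n%:R ^+ k / n%:R ^+ 2.
Proof.
have [c c0 cP] := @expr_remainder_bound R k; exists c => n n0.
pose rem (s x : R) := ((1 - p n.+1) * expr_remainder k (2 * s - n%:R) (2 * x - 1) +
  p n.+1 * - expr_remainder k (2 * s - n%:R) (- (2 * x - 1))) * (2 * x - 1).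
have -> : walk_cross_moment k n.+1 = (1 - 2 * p n.+1) * walk_cross_moment k n +
    (k%:R * walk_moment k.-1 n + state_mean X n rem).
  rewrite /walk_cross_moment (state_meanS turningX)// -!state_meanZ -!state_meanD.
  apply: eq_state_mean => s x sn.
  rewrite (_ : 2 * (s%:R + x%:R) - _ = (2 * s%:R - n%:R) + (2 * x%:R - 1)); last first.
    by rewrite -natr1; ring.
  rewrite (_ : 2 * (s%:R + (1 - x%:R)) - _ =
    (2 * s%:R - n%:R) + - (2 * x%:R - 1)); last first.
    by rewrite -natr1; ring.
  rewrite /rem /expr_remainder.
  have : (2 * (x%:R : R) - 1) ^+ 2 = 1 by case: x {sn} => /=; ring.
  rewrite (_ : 2 * (1 - x%:R) - 1 = - (2 * x%:R - 1)); last by ring.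
  move: (2 * x%:R - 1) => y y2.
  apply/eqP; rewrite -subr_eq0.
  rewrite (_ : _ - _ = (y ^+ 2 - 1) * (k%:R * (2 * s%:R - n%:R) ^+ k.-1)); last by ring.
  by rewrite y2 subrr mul0r.
rewrite (_ : _ - _ - _ = state_mean X n rem); last by ring.
apply: (state_mean_norm turningX) => // s x sn.
have y1 : `|2 * (x%:R : R) - 1| <= 1 by case: x {sn} => /=; rewrite ler_norml; lra.
by apply: norm_mix => //; rewrite ?normrN; apply: cP; rewrite ?normrN// walk_norm_le.
Qed.

End moments.

(** * Convergence of the moments *)

Lemma sym_beta_mean_sum {R : realType} (a : R) (n : nat) (r : nat -> R)
    (f : nat -> R -> R) : 0 < a -> (forall i, continuous (f i)) ->
  continuous (fun x => \sum_(i < n) r i * f i x) /\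
  sym_beta_mean a (fun x => \sum_(i < n) r i * f i x) =
  \sum_(i < n) r i * sym_beta_mean a (f i).
Proof.
move=> a0 cf; elim: n => [|n [cn IH]].
  rewrite big_ord0 (_ : (fun _ => _) = cst 0); last first.
    by apply/funext => x; rewrite big_ord0.
  by split; [exact: cst_continuous|exact: sym_beta_mean0].
rewrite (_ : (fun _ => _) = fun x => r n * f n x + \sum_(i < n) r i * f i x); last first.
  by apply/funext => x; rewrite big_ord_recr addrC.
split; last by rewrite sym_beta_mean_linear// IH [RHS]big_ord_recr addrC.
move=> x; apply: (@continuousD _ _ _ (fun x => r n * f n x)); last exact: cn.
by apply: (@continuousM _ _ (cst (r n))); [exact: cst_continuous|exact: cf].
Qed.

Section limit.
Context {R : realType} (a : R) (a0 : 0 < a) {d : measure_display}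
  {T : measurableType d} (P : probability T R) (X : nat -> {RV P >-> R}).
Let p (n : nat) : R := Num.min (a / n%:R) 1.
Context (turningX : coin_turning_process p X).

Let p01 n : 0 <= p n <= 1.
Proof. by rewrite /p le_min ler01 divr_ge0 ?(ltW a0)//= ge_min lexx orbT. Qed.

Let p_near : \forall n \near \oo, p n.+1 = a / n.+1%:R.
Proof.
near=> n; rewrite /p min_l// ler_pdivrMr// mul1r.
rewrite (@le_trans _ _ n%:R)// ?ler_nat//; near: n; exact: nbhs_infty_ger.
Unshelve. all: by end_near.
Qed.

Let cvg_1_2p : 1 - 2 * p n.+1 @[n --> \oo] --> (1 : R).
Proof.
have h : 1 - 2 * a * harmonic n @[n --> \oo] --> (1 : R).
  rewrite -[X in _ --> X](subr0 (1 : R)) -[X in _ - X](mulr0 (2 * a)).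
  apply: cvgB; first exact: cvg_cst.
  by apply: cvgM; [exact: cvg_cst|exact: cvg_harmonic].
apply: cvg_trans h; apply: near_eq_cvg; apply: filterS p_near => n /= ->.
by rewrite mulrA.
Qed.

Let beta_moment (k : nat) : R := sym_beta_mean a (fun x => (2 * x - 1) ^+ k).

(** Simultaneous induction: the moment of order [k.+1] is driven by the cross moment of order [k],
    and the cross moment of order [k.+1] by the moment of order [k]. *)
Lemma cvg_walk_moments (k : nat) :
  walk_moment X k n / n%:R ^+ k @[n --> \oo] --> beta_moment k /\
  walk_cross_moment X k n / n%:R ^+ k @[n --> \oo] --> beta_moment k.+1.
Proof.
have a20 : 0 < 2 * a by rewrite mulr_gt0.
elim: k => [|k [IHm IHc]]; split.
- have -> : beta_moment 0 = 1.
    by rewrite -[RHS](sym_beta_mean1 a0).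
  apply: cvg_near_cst; near=> n.
  rewrite divr1; apply: (state_mean_cst turningX).
  by near: n; exact: nbhs_infty_gt.
- have [c cP] := walk_cross_momentS turningX p01 0.
  have -> : beta_moment 1 = 0 / (0%:R + 2 * a).
    have := sym_beta_mean_affineX 0 a0; rewrite add0r mul0r => /eqP.
    by rewrite mulf_eq0 gt_eqF//= => /eqP; rewrite mul0r.
  have := cvg0_remainder cP.
  apply: cvg_poly_growth; first by rewrite add0r.
  by apply: filterS p_near => n ->; field; rewrite nat1r pnatr_eq0.
- have [c cP] := walk_momentS turningX p01 k.+1.
  have k0 : 0 < k.+1%:R + 0 :> R by rewrite addr0.
  have -> : beta_moment k.+1 = (1 * (k.+1%:R * beta_moment k.+1) + 0) / (k.+1%:R + 0).
    by field.
  (* Here [c = 0]: the whole increment is treated as forcing. *)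
  apply: (@cvg_poly_growth _ _
    (fun n => walk_moment X k.+1 n.+1 - walk_moment X k.+1 n)) => //.
    by apply: nearW => n; ring.
  apply: cvg_trans (cvgD (cvgM cvg_1_2p (cvg_lead_term IHc)) (cvg0_remainder cP)).
  apply: near_eq_cvg; apply: nearW => n /=.
  by rewrite fctE /=; field; rewrite ?nat1r ?expf_neq0 ?pnatr_eq0.
- have [c cP] := walk_cross_momentS turningX p01 k.+1.
  have k0 : 0 < k.+1%:R + 2 * a by rewrite addr_gt0.
  have -> : beta_moment k.+2 = (k.+1%:R * beta_moment k + 0) / (k.+1%:R + 2 * a).
    have := sym_beta_mean_affineX k.+1 a0; rewrite -/(beta_moment _) -/(beta_moment _) /=.
    by rewrite addr0 => <-; rewrite mulrAC divff ?mul1r ?gt_eqF.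
  (* Here [c = 2 * a], from [1 - 2 * p n.+1 = 1 - 2 * a / n.+1] for large [n]. *)
  apply: (@cvg_poly_growth _ _ (fun n => walk_cross_moment X k.+1 n.+1 -
     (1 - 2 * p n.+1) * walk_cross_moment X k.+1 n)) => //.
    by apply: filterS p_near => n ->; ring.
  apply: cvg_trans (cvgD (cvg_lead_term IHm) (cvg0_remainder cP)).
  apply: near_eq_cvg; apply: nearW => n /=.
  by rewrite fctE /=; field; rewrite ?nat1r ?expf_neq0 ?pnatr_eq0.
Unshelve. all: by end_near.
Qed.

Lemma cvg_state_mean_horner (q : {poly R}) :
  state_mean X n (fun s _ => q.[n%:R^-1 * s]) @[n --> \oo] -->
  sym_beta_mean a (horner q).
Proof.
(* The coefficients of [r] are those of [q] in powers of [2 * x - 1], matching W(n) / n = 2 S n / n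
   - 1. *)
pose r := q \Po (2^-1 *: ('X + 1)).
have qE x : q.[x] = \sum_(i < size r) r`_i * (2 * x - 1) ^+ i.
  by rewrite -horner_coef horner_comp !hornerE; congr horner; field.
have -> : horner q = fun x => \sum_(i < size r) r`_i * (2 * x - 1) ^+ i.
  exact/funext.
have [_ ->] := sym_beta_mean_sum (size r) (fun i => r`_i) a0 (@continuous_affineX R).
have h : \sum_(i < size r) r`_i * (walk_moment X i n / n%:R ^+ i) @[n --> \oo] -->
    \sum_(i < size r) r`_i * beta_moment i.
  apply: cvg_big => [|i _]; first exact: add_continuous.
  apply: cvgM; first exact: cvg_cst.
  by have [] := cvg_walk_moments i.
apply: cvg_trans h; apply: near_eq_cvg; near=> n.
have n0 : n%:R != 0 :> R.
  by rewrite pnatr_eq0 -lt0n; near: n; exact: nbhs_infty_gt.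
rewrite /walk_moment /state_mean.
under [RHS]eq_bigr do rewrite mulr_suml.
rewrite [RHS]exchange_big; apply: eq_bigr => i _.
rewrite mulr_suml mulr_sumr; apply: eq_bigr => j _.
rewrite (_ : 2 * (n%:R^-1 * _) - 1 = (2 * (j.1 : nat)%:R - n%:R) / n%:R); last by field.
by rewrite expr_div_n; ring.
Unshelve. all: by end_near.
Qed.

End limit.

(** * From polynomials to continuous test functions *)

Lemma continuous_horner {R : realType} (q : {poly R}) : continuous (horner q).
Proof.
move=> x; apply/differentiable_continuous/derivable1_diffP.
exact: derivable_horner.
Qed.

(** An [eps / 3] argument: S_n / n lies in [0, 1], so replacing [f] by a uniformly close polynomial
    costs at most [eps / 3] on either side. *)
Lemma cvg_state_mean {R : realType} (a : R) {d : measure_display}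
    {T : measurableType d} (P : probability T R) (X : nat -> {RV P >-> R})
    (f : R -> R) :
  0 < a -> coin_turning_process (fun n => Num.min (a / n%:R) 1) X ->
  continuous f ->
  state_mean X n (fun s _ => f (n%:R^-1 * s)) @[n --> \oo] --> sym_beta_mean a f.
Proof.
move=> a0 turningX cf; apply/cvgrPdist_le => eps eps0.
have e0 : 0 < eps / 3 by rewrite divr_gt0.
have [q fq] := weierstrass_itv01 cf e0.
have /cvgrPdist_le/(_ _ e0) := @cvg_state_mean_horner _ _ a0 _ _ _ _ turningX q.
have := sym_beta_mean_dist a0 cf (@continuous_horner R q) fq.
set l := sym_beta_mean a f; set l' := sym_beta_mean a _ => ll' h.
near=> n.
have n0 : (0 < n)%N by near: n; exact: nbhs_infty_gt.
pose u g := state_mean X n (fun s _ => g (n%:R^-1 * s)).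
have uq : `|l' - u (horner q)| <= eps / 3 by rewrite /u; near: n; exact: h.
have uf : `|u f - u (horner q)| <= eps / 3.
  have -> : u f - u (horner q) =
      state_mean X n (fun s _ => f (n%:R^-1 * s) + -1 * q.[n%:R^-1 * s]).
    by rewrite state_meanD state_meanZ mulN1r.
  apply: (state_mean_norm turningX) => // s _ sn; rewrite mulN1r fq//.
  by rewrite mulr_ge0//= mulrC ler_pdivrMr ?ltr0n// mul1r ler_nat.
rewrite -/(u f) (le_trans (ler_distD l' _ _))//.
rewrite (_ : eps = eps / 3 + (eps / 3 + eps / 3)); last by field.
rewrite lerD// (le_trans (ler_distD (u (horner q)) _ _))// lerD//.
by rewrite distrC.
Unshelve. all: by end_near.
Qed.

Theorem theorem2 (R : realType) (a : R) (a0 : 0 < a)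
    (d : measure_display) (T : measurableType d) (P : probability T R)
    (X : nat -> {RV P >-> R}) :
  coin_turning_process (fun n => Num.min (a / n%:R) 1) X ->
  weak_cvg
    (fun N => distribution P (N%:R^-1 *: \sum_(1 <= i < N.+1) X i))
    (sym_beta_prob (PosNum a0)).
Proof.
move=> turningX f cf bf; rewrite integral_sym_beta_prob//.
have mf : measurable_fun setT f by exact: continuous_measurable_fun.
have h : (state_mean X n (fun s _ => f (n%:R^-1 * s)))%:E @[n --> \oo] -->
    (sym_beta_mean a f)%:E.
  by apply: cvg_EFin; [exact: nearW|exact: cvg_state_mean].
(* The integral against the law is a [state_mean] only from [n = 1] on, which suffices for the
   limit. *)
apply: cvg_trans h; apply: near_eq_cvg; near=> n.
have n0 : (0 < n)%N by near: n; exact: nbhs_infty_gt.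
rewrite /= -(integral_state turningX (fun s _ => f (n%:R^-1 * s)) n0).
rewrite integral_distribution//.
- apply: eq_integral => w _ /=; congr (f _)%:E.
  by rewrite /heads -mfun_sum.
- exact/measurable_EFinP.
- apply: measurable_bounded_integrable => //.
  + by apply: (@le_lt_trans _ _ 1%E); [exact: probability_le1|exact: ltry].
  + exact: measurableT_comp.
  + have [M [Mr fM]] := bf; exists M; split => // y My w _ /=.
    exact: fM.
Unshelve. all: by end_near.
Qed.
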